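(* Let $\{(Y_t,X_t):t\ge1\}$, $Y_t\in\mathbb R$, $X_t\in\mathbb R^k$, have law $P^{\mathrm{obs}}_\infty$, and for each $T\ge1$ let $\Theta_I^{(T)}$ be the $T$-period sharp set formed from the marginal law $P^{\mathrm{obs}}_T$ of the first $T$ periods (defined in the context). Then for every $T\ge1$, $$\Theta_I^{(T+1)}\subseteq\Theta_I^{(T)}.$$ No stationarity, independence, exchangeability, continuity, or common-distribution condition across periods is required.
   Context: $\tau\in(0,1)$, $k\ge1$, $\mathcal B\subseteq\mathbb R^k$. $Y^{(T)}=(Y_1,\dots,Y_T)'$, $X^{(T)}=(X_1,\dots,X_T)$, and $P^{\mathrm{obs}}_T$ is the law of $(Y^{(T)},X^{(T)})$ under $P^{\mathrm{obs}}_\infty$. For $b\in\mathcal B$, $\mathcal C_{T,b}(P_T^{\mathrm{obs}})$ is the set of Borel probability laws of $(Y^{(T)},X^{(T)},A)$, $A\in\mathbb R$, with $(Y^{(T)},X^{(T)})$-marginal $P_T^{\mathrm{obs}}$ and satisfying, a.s. and for every $t\le T$, $P\{Y_t-X_t'b\le A\mid X^{(T)},A\}\ge\tau$ and $P\{Y_t-X_t'b<A\mid X^{(T)},A\}\le\tau$. $\Theta_I^{(T)}=\{b\in\mathcal B:\mathcal C_{T,b}(P_T^{\mathrm{obs}})\ne\varnothing\}$. *)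

(* Defs.v *)
From HB Require Import structures.
From mathcomp Require Import all_boot all_order all_algebra.
From mathcomp Require Import all_classical all_reals all_analysis.

Set Implicit Arguments.
Unset Strict Implicit.
Unset Printing Implicit Defensive.

Import Order.TTheory GRing.Theory Num.Theory.
Import numFieldNormedType.Exports.

Local Open Scope classical_set_scope.
Local Open Scope ring_scope.

(* [R^k] is [k.-tuple R]: tuples, unlike ['rV[R]_k], carry a measurable
   structure in the library (the product, i.e. Borel, sigma-algebra). *)
Definition dotp {R : realType} {k : nat} (x b : k.-tuple R) : R :=
  \sum_(i < k) tnth x i * tnth b i.

(* Paths ((Y_t, X_t))_t with the product sigma-algebra.  Time starts at 0 here:
   period t >= 1 of the mathematics is index t.-1. *)
Definition cylinders (R : realType) (k : nat) :
    set (set (nat -> R * k.-tuple R)) :=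
  [set C | exists t : nat, exists2 D : set (R * k.-tuple R),
     measurable D & C = [set w | D (w t)]].

Definition path_space (R : realType) (k : nat) :=
  g_sigma_algebraType (@cylinders R k).

HB.instance Definition _ (R : realType) (k : nat) :=
  Measurable.copy (path_space R k) (g_sigma_algebraType (@cylinders R k)).

(* The values of (Y^(T), X^(T)). *)
Notation obs_space R k T := (T.-tuple R * T.-tuple (k.-tuple R))%type.

Definition truncate {R : realType} {k : nat} (T : nat) (w : path_space R k) :
    obs_space R k T :=
  ([tuple (w t).1 | t < T], [tuple (w t).2 | t < T]).

Lemma measurable_coord {R : realType} {k : nat} (t : nat) :
  measurable_fun [set: path_space R k]
    (fun w : path_space R k => w t : R * k.-tuple R).
Proof.
move=> _ D mD; rewrite setTI; apply: sub_sigma_algebra.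
by exists t, D.
Qed.

Lemma measurable_truncate {R : realType} {k : nat} (T : nat) :
  measurable_fun [set: path_space R k] (@truncate R k T).
Proof.
apply/measurable_fun_pairP; split; apply/measurable_fun_tnthP => i.
- rewrite (_ : _ \o _ = fst \o (fun w : path_space R k => w i)).
    exact: (measurableT_comp measurable_fst (measurable_coord i)).
  by apply/funext => w /=; rewrite tnth_mktuple.
- rewrite (_ : _ \o _ = snd \o (fun w : path_space R k => w i)).
    exact: (measurableT_comp measurable_snd (measurable_coord i)).
  by apply/funext => w /=; rewrite tnth_mktuple.
Qed.

HB.instance Definition _ (R : realType) (k T : nat) :=
  isMeasurableFun.Build _ _ _ _ (@truncate R k T) (@measurable_truncate R k T).

Definition obs_law {R : realType} {k : nat}
    (Pinf : probability (path_space R k) R) (T : nat) :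
    probability (obs_space R k T) R :=
  distribution Pinf (@truncate R k T).

(* [f] is a version of the conditional probability [Q(E | Z)], i.e. given the
   sigma-algebra generated by [Z]. *)
Definition is_cond_prob {R : realType} {d d' : measure_display}
    {Omega : measurableType d} {V : measurableType d'}
    (Q : probability Omega R) (Z : Omega -> V) (E : set Omega)
    (f : Omega -> R) : Prop :=
  [/\ measurable_fun [set: g_sigma_algebra_preimageType Z] f,
      Q.-integrable [set: Omega] (EFin \o f) &
      forall C : set Omega, g_sigma_algebra_preimage Z C ->
        (\int[Q]_(w in C) (f w)%:E = Q (E `&` C))%E].

(* [Q(E | Z) >= tau] and [Q(E | Z) <= tau], Q-almost surely; versions exist and
   agree Q-almost surely, so it does not matter which one is used. *)
Definition cond_prob_ge {R : realType} {d d' : measure_display}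
    {Omega : measurableType d} {V : measurableType d'}
    (Q : probability Omega R) (Z : Omega -> V) (E : set Omega) (tau : R) :=
  exists2 f, is_cond_prob Q Z E f & {ae Q, forall w, tau <= f w}.

Definition cond_prob_le {R : realType} {d d' : measure_display}
    {Omega : measurableType d} {V : measurableType d'}
    (Q : probability Omega R) (Z : Omega -> V) (E : set Omega) (tau : R) :=
  exists2 f, is_cond_prob Q Z E f & {ae Q, forall w, f w <= tau}.

Section LatentLaws.
Context {R : realType} {k T : nat}.

(* The values ((Y^(T), X^(T)), A). *)
Let Omega := (obs_space R k T * R)%type.

Definition latent (w : Omega) : R := w.2.

Definition conditioning (w : Omega) : T.-tuple (k.-tuple R) * R :=
  (w.1.2, latent w).

Definition residual (b : k.-tuple R) (t : 'I_T) (w : Omega) : R :=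
  tnth w.1.1 t - dotp (tnth w.1.2 t) b.

Definition latent_laws (tau : R) (b : k.-tuple R)
    (P : probability (obs_space R k T) R) : set (probability Omega R) :=
  [set Q : probability Omega R |
    (forall D : set (obs_space R k T), measurable D ->
       pushforward Q fst D = P D) /\
    (forall t : 'I_T,
       cond_prob_ge Q conditioning [set w | residual b t w <= latent w] tau /\
       cond_prob_le Q conditioning [set w | residual b t w < latent w] tau)].

End LatentLaws.

Definition sharp_set {R : realType} {k : nat} (tau : R)
    (B : set (k.-tuple R)) (Pinf : probability (path_space R k) R) (T : nat) :
    set (k.-tuple R) :=
  [set b | B b /\ latent_laws tau b (obs_law Pinf T) !=set0].

(* Main.v *)
(* A law of (Y^(T+1), X^(T+1), A) compatible with b is pushed forward by dropping
   period T+1.  The condition Q(E | Z) >= tau almost surely says exactly that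
   tau Q(C) <= Q(E /\ C) for every C in the sigma-algebra of Z, and likewise for
   <=; in this form it passes to the smaller sigma-algebra of (X^(T), A). *)
From HB Require Import structures.
Require Import Defs.
From mathcomp Require Import all_boot all_order all_algebra.
From mathcomp Require Import all_classical all_reals all_analysis.
From mathcomp Require Import measurable_realfun.

Set Implicit Arguments.
Unset Strict Implicit.
Unset Printing Implicit Defensive.

Import Order.TTheory GRing.Theory Num.Theory.

Local Open Scope classical_set_scope.
Local Open Scope ring_scope.

(** * Conditional probability bounds as inequalities between set functions *)

Section cond_prob.
Context {R : realType} {d d' : measure_display}
  {Omega : measurableType d} {V : measurableType d'}
  (Q : probability Omega R) (Z : {mfun Omega >-> V}).
Local Open Scope ereal_scope.

Lemma g_sigma_algebra_preimage_measurable (C : set Omega) :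
  g_sigma_algebra_preimage Z C -> measurable C.
Proof. by case=> D mD <-; rewrite setTI; exact: measurable_funPTI. Qed.

(** Both functions are measurable for the sigma-algebra of [Z], so the set where the inequality
    fails is itself an admissible [C]; testing on it shows that it is null. *)
Lemma ae_le_integralP (f g : Omega -> R) :
    measurable_fun [set: g_sigma_algebra_preimageType Z] f ->
    measurable_fun [set: g_sigma_algebra_preimageType Z] g ->
    Q.-integrable [set: Omega] (EFin \o f) ->
    Q.-integrable [set: Omega] (EFin \o g) ->
  {ae Q, forall w, (f w <= g w)%R} <->
  forall C, g_sigma_algebra_preimage Z C ->
    \int[Q]_(w in C) (f w)%:E <= \int[Q]_(w in C) (g w)%:E.
Proof.
move=> mf mg If Ig.
have intC C h : g_sigma_algebra_preimage Z C ->
    Q.-integrable [set: Omega] (EFin \o h) -> Q.-integrable C (EFin \o h).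
  move=> /g_sigma_algebra_preimage_measurable mC.
  exact: integrableS.
have subint C u v : g_sigma_algebra_preimage Z C ->
    Q.-integrable [set: Omega] (EFin \o u) ->
    Q.-integrable [set: Omega] (EFin \o v) ->
    \int[Q]_(w in C) (u w - v w)%:E =
    \int[Q]_(w in C) (u w)%:E - \int[Q]_(w in C) (v w)%:E.
  move=> ZC Iu Iv; have mC := g_sigma_algebra_preimage_measurable ZC.
  by rewrite -integralB//; [exact: intC|exact: intC].
have mB C u v : Q.-integrable [set: Omega] (EFin \o u) ->
    Q.-integrable [set: Omega] (EFin \o v) ->
    measurable_fun C (fun w => u w - v w)%R.
  move=> /measurable_int/measurable_EFinP mu /measurable_int/measurable_EFinP mv.
  by apply: measurable_funTS; exact: measurable_funB.
have fin C h : g_sigma_algebra_preimage Z C ->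
    Q.-integrable [set: Omega] (EFin \o h) ->
    \int[Q]_(w in C) (h w)%:E \is a fin_num.
  move=> ZC Ih; apply: integrable_fin_num; last exact: intC.
  exact: g_sigma_algebra_preimage_measurable.
split=> [fg C ZC|fg].
  have mC := g_sigma_algebra_preimage_measurable ZC.
  rewrite -sube_ge0; last by rewrite fin.
  rewrite -subint//.
  (* The difference is nonnegative only almost everywhere; its absolute value is nonnegative
     everywhere and has the same integral. *)
  rewrite (@ae_eq_integral _ _ _ Q C (EFin \o (fun w => `|g w - f w|%R)))//.
  - by apply: integral_ge0 => w _; rewrite lee_fin.
  - by apply/measurable_EFinP; exact: mB.
  - apply/measurable_EFinP; apply: measurableT_comp => //; exact: mB.
  - apply: filterS fg => w fgw _ /=.
    by rewrite ger0_norm// subr_ge0.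
pose N := [set w : g_sigma_algebra_preimageType Z | (g w < f w)%R].
have ZN : g_sigma_algebra_preimage Z N.
  have := measurable_fun_ltr mg mf measurableT (I : measurable [set true]).
  by rewrite setTI preimage_true.
have mN := g_sigma_algebra_preimage_measurable ZN.
(* On [N] the integrand is [f - g], so the hypothesis at [C = N] bounds the integral above by 0. *)
have : \int[Q]_(w in N) `|(f w - g w)%:E| = 0.
  apply/eqP; rewrite eq_le integral_ge0 ?andbT//.
  under eq_integral => w /set_mem Nw.
    rewrite gee0_abs; last by rewrite lee_fin subr_ge0 ltW.
    over.
  by rewrite subint// sube_le0 fg.
have /measurable_EFinP mfg := mB N _ _ If Ig.
move/(ae_eq_integral_abs Q mN mfg).
apply: filterS => w /= gf; rewrite leNgt; apply/negP => Nw.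
by have /eqP := gf Nw; rewrite eqe subr_eq0 gt_eqF.
Qed.

(* The version is the Radon-Nikodym derivative, on the space of values of [Z],
   of [D |-> Q (E `&` Z @^-1` D)] with respect to the law of [Z]. *)
Lemma exists_cond_prob (E : set Omega) : measurable E ->
  exists f, is_cond_prob Q Z E f.
Proof.
move=> mE.
have Eoo : Q E < +oo by rewrite -ge0_fin_numE// fin_num_measure.
(* [nu0] is [Q] restricted to [E], dominated by [Q]; pushing both forward along [Z] preserves the
   domination. *)
pose nu0 := charge_of_finite_measure (mfrestr mE Eoo).
have nu0Q : nu0 `<< Q.
  apply/null_content_dominatesP => A mA QA0.
  by apply/eqP; rewrite -measure_le0 -QA0 measureIl.
pose nu := measure_function_pushforward__canonical__charge_Charge nu0
  (measurable_funPT Z).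
pose mu := distribution Q Z.
have numu : nu `<< mu by exact: dominates_pushforward.
pose g := Radon_Nikodym nu mu.
have Ig : mu.-integrable [set: V] g by exact: Radon_Nikodym_integrable.
(* [g] is extended-real valued; being finite everywhere, it loses nothing under [fine]. *)
have gfin x : g x \is a fin_num by exact: Radon_Nikodym_fin_num.
have IgZ : Q.-integrable [set: Omega] (g \o Z).
  apply/integrableP; split.
    by apply: measurableT_comp => //; exact: measurable_int Ig.
  have /integrableP[mg] := Ig; rewrite ge0_integral_distribution//.
  exact: measurableT_comp.
exists (fine \o g \o Z).
have gZ : EFin \o (fine \o g \o Z) = g \o Z.
  by apply/funext => w /=; rewrite fineK.
split.
- move=> _ D mD; exists ((fine \o g) @^-1` D) => //.
  rewrite -[X in measurable X]setTI.
  by apply: measurableT_comp => //; exact: measurable_int Ig.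
- by rewrite gZ.
(* With [C] the preimage of [D] under [Z], a change of variables gives the integral of [g] over [D]
   against [mu], which is [nu D]. *)
- move=> _ [D mD <-]; rewrite setTI.
  under eq_integral do rewrite -[(_ _)%:E]/((EFin \o (fine \o g \o Z)) _) gZ.
  rewrite -integral_pushforward//.
  + by rewrite setIC; exact/esym/(Radon_Nikodym_integral numu mD).
  + exact: measurable_int Ig.
  + by apply: integrableS IgZ => //; exact: measurable_funPTI.
Qed.

(** A version is compared with the constant [tau] through their integrals over each [C]. The
    converse direction rests on the existence of a version. *)
Lemma cond_prob_geP (E : set Omega) (tau : R) : measurable E ->
  cond_prob_ge Q Z E tau <->
  forall C, g_sigma_algebra_preimage Z C -> tau%:E * Q C <= Q (E `&` C).
Proof.
move=> mE.
have Icst : Q.-integrable [set: Omega] (EFin \o cst tau).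
  exact: finite_measure_integrable_cst.
have intcst C : g_sigma_algebra_preimage Z C ->
    \int[Q]_(w in C) (cst tau w)%:E = tau%:E * Q C.
  by move=> /g_sigma_algebra_preimage_measurable mC; rewrite -integral_cst.
split=> [[f [mf If fE] /ae_le_integralP tauf] C ZC|tauE].
  by rewrite -fE// -intcst// tauf.
have [f [mf If fE]] := exists_cond_prob mE.
exists f => //; apply/(ae_le_integralP (f := cst tau)) => // C ZC.
by rewrite fE// intcst// tauE.
Qed.

Lemma cond_prob_leP (E : set Omega) (tau : R) : measurable E ->
  cond_prob_le Q Z E tau <->
  forall C, g_sigma_algebra_preimage Z C -> Q (E `&` C) <= tau%:E * Q C.
Proof.
move=> mE.
have Icst : Q.-integrable [set: Omega] (EFin \o cst tau).
  exact: finite_measure_integrable_cst.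
have intcst C : g_sigma_algebra_preimage Z C ->
    \int[Q]_(w in C) (cst tau w)%:E = tau%:E * Q C.
  by move=> /g_sigma_algebra_preimage_measurable mC; rewrite -integral_cst.
split=> [[f [mf If fE] /(ae_le_integralP (g := cst tau)) ftau] C ZC|Etau].
  by rewrite -fE// -intcst// ftau.
have [f [mf If fE]] := exists_cond_prob mE.
exists f => //; apply/(ae_le_integralP (g := cst tau)) => // C ZC.
by rewrite fE// intcst// Etau.
Qed.

End cond_prob.

(** * Passage to a coarser conditioning variable under a pushforward *)

Section coarsening.
Context {R : realType} {d1 d2 e1 e2 : measure_display}
  {Omega1 : measurableType d1} {Omega2 : measurableType d2}
  {V1 : measurableType e1} {V2 : measurableType e2}
  (Q : probability Omega1 R) (p : {mfun Omega1 >-> Omega2})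
  (Z1 : {mfun Omega1 >-> V1}) (Z2 : {mfun Omega2 >-> V2}) (h : V1 -> V2).
Hypotheses (mh : measurable_fun [set: V1] h)
  (hZ : forall w, Z2 (p w) = h (Z1 w)).

(** Since [Z2 \o p = h \o Z1], pulling [D] back along [Z2] and [p] is pulling it back along [h] and
    [Z1]. *)
Lemma g_sigma_algebra_preimage_coarsen (C : set Omega2) :
  g_sigma_algebra_preimage Z2 C -> g_sigma_algebra_preimage Z1 (p @^-1` C).
Proof.
case=> D mD <-; exists (h @^-1` D).
  by rewrite -[X in measurable X]setTI; exact: mh.
by rewrite !setTI; apply/seteqP; split=> w /=; rewrite hZ.
Qed.

(** For the law of [p], the inequality at [C] is by definition the one for [Q] at the preimage of
    [C], where the hypothesis supplies it. *)
Lemma cond_prob_ge_coarsen (E : set Omega2) (tau : R) : measurable E ->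
  cond_prob_ge Q Z1 (p @^-1` E) tau ->
  cond_prob_ge (distribution Q p) Z2 E tau.
Proof.
move=> mE /cond_prob_geP tauE; apply/cond_prob_geP => // C ZC.
apply: tauE; first exact: measurable_funPTI.
exact: g_sigma_algebra_preimage_coarsen.
Qed.

Lemma cond_prob_le_coarsen (E : set Omega2) (tau : R) : measurable E ->
  cond_prob_le Q Z1 (p @^-1` E) tau ->
  cond_prob_le (distribution Q p) Z2 E tau.
Proof.
move=> mE /cond_prob_leP Etau; apply/cond_prob_leP => // C ZC.
apply: Etau; first exact: measurable_funPTI.
exact: g_sigma_algebra_preimage_coarsen.
Qed.

End coarsening.

(** * Measurability of the conditioning variable and of the residual events *)

Section latent_measurability.
Context {R : realType} {k T : nat}.
Implicit Types (b : k.-tuple R) (t : 'I_T).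

Lemma measurable_conditioning : measurable_fun setT (@conditioning R k T).
Proof.
apply/measurable_fun_pairP; split; last exact: measurable_snd.
exact: (measurableT_comp measurable_snd measurable_fst).
Qed.

HB.instance Definition _ :=
  isMeasurableFun.Build _ _ _ _ (@conditioning R k T) measurable_conditioning.

Lemma measurable_dotp b : measurable_fun setT (fun x : k.-tuple R => dotp x b).
Proof.
apply: measurable_sum => i; apply: measurable_funM => //.
exact: measurable_tnth.
Qed.

Lemma measurable_residual b t : measurable_fun setT (@residual R k T b t).
Proof.
apply: measurable_funB.
  apply: (measurableT_comp (measurable_tnth t)).
  exact: (measurableT_comp measurable_fst measurable_fst).
apply: (measurableT_comp (measurable_dotp b)).
apply: (measurableT_comp (measurable_tnth t)).
exact: (measurableT_comp measurable_snd measurable_fst).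
Qed.

Lemma measurable_residual_le b t :
  measurable [set w : obs_space R k T * R | residual b t w <= latent w].
Proof.
have := measurable_fun_ler (measurable_residual b t) measurable_snd
  measurableT (I : measurable [set true]).
by rewrite setTI preimage_true.
Qed.

Lemma measurable_residual_lt b t :
  measurable [set w : obs_space R k T * R | residual b t w < latent w].
Proof.
have := measurable_fun_ltr (measurable_residual b t) measurable_snd
  measurableT (I : measurable [set true]).
by rewrite setTI preimage_true.
Qed.

End latent_measurability.

(** * Restriction to the first [m] of [n] periods *)

Definition prefix_tuple {A : Type} {m n : nat} (mn : (m <= n)%N)
    (s : n.-tuple A) : m.-tuple A :=
  [tuple tnth s (widen_ord mn t) | t < m].

Lemma measurable_prefix_tuple {d} {A : measurableType d} {m n : nat}
  (mn : (m <= n)%N) : measurable_fun setT (@prefix_tuple A m n mn).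
Proof.
apply/measurable_fun_tnthP => t.
rewrite (_ : _ \o _ = (@tnth n A)^~ (widen_ord mn t)).
  exact: measurable_tnth.
by apply/funext => s /=; rewrite tnth_mktuple.
Qed.

Section first_periods.
Context {R : realType} {k m n : nat}.
Variable mn : (m <= n)%N.

Definition first_obs (w : obs_space R k n) : obs_space R k m :=
  (prefix_tuple mn w.1, prefix_tuple mn w.2).

Definition first_periods (w : obs_space R k n * R) : obs_space R k m * R :=
  (first_obs w.1, w.2).

Lemma measurable_first_obs : measurable_fun setT first_obs.
Proof.
by apply/measurable_fun_pairP; split;
  apply: (measurableT_comp (measurable_prefix_tuple mn)).
Qed.

Lemma measurable_first_periods : measurable_fun setT first_periods.
Proof.
apply/measurable_fun_pairP; split; last exact: measurable_snd.
exact: (measurableT_comp measurable_first_obs measurable_fst).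
Qed.

HB.instance Definition _ :=
  isMeasurableFun.Build _ _ _ _ first_periods measurable_first_periods.

Lemma first_obs_truncate (w : path_space R k) :
  first_obs (truncate n w) = truncate m w.
Proof.
by congr pair; apply: eq_from_tnth => t; rewrite !tnth_mktuple.
Qed.

(** Turns the events of period [t] into preimages under [first_periods], as the coarsening lemmas
    require. *)
Lemma residual_widen (b : k.-tuple R) (t : 'I_m) :
  @residual R k n b (widen_ord mn t) = residual b t \o first_periods.
Proof. by apply/funext => w; rewrite /residual /= !tnth_mktuple. Qed.

Lemma latent_laws_first_periods (tau : R) (b : k.-tuple R)
    (Pinf : probability (path_space R k) R)
    (Q : probability (obs_space R k n * R)%type R) :
  latent_laws tau b (obs_law Pinf n) Q ->
  latent_laws tau b (obs_law Pinf m) (distribution Q first_periods).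
Proof.
move=> [Qobs Qtau]; split=> [D mD|t].
  have mD' : measurable (first_obs @^-1` D).
    by rewrite -[X in measurable X]setTI; exact: measurable_first_obs.
  (* Dropping periods commutes with forgetting [A], so the new marginal at [D] is the old one at the
     preimage of [D] under [first_obs]. *)
  rewrite -[LHS]/(pushforward Q fst (first_obs @^-1` D)) Qobs//.
  rewrite /obs_law /distribution /pushforward; congr (Pinf _).
  by apply/seteqP; split=> w /=; rewrite first_obs_truncate.
(* [h] expresses the shorter conditioning variable as a function of the longer one: it truncates the
   regressors and keeps [A]. *)
pose h (v : n.-tuple (k.-tuple R) * R) := (prefix_tuple mn v.1, v.2).
have mh : measurable_fun setT h.
  apply/measurable_fun_pairP; split; last exact: measurable_snd.
  exact: (measurableT_comp (measurable_prefix_tuple mn) measurable_fst).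
have := Qtau (widen_ord mn t); rewrite residual_widen => -[Qge Qle]; split.
  apply: (cond_prob_ge_coarsen (Z1 := conditioning) mh) Qge => //.
  exact: measurable_residual_le.
apply: (cond_prob_le_coarsen (Z1 := conditioning) mh) Qle => //.
exact: measurable_residual_lt.
Qed.

End first_periods.

Theorem proposition7p1 (R : realType) (tau : R) (k : nat)
    (B : set (k.-tuple R)) (Pinf : probability (path_space R k) R)
    (htau0 : 0 < tau) (htau1 : tau < 1) (hk : (1 <= k)%N) :
  forall T : nat, (1 <= T)%N ->
    sharp_set tau B Pinf T.+1 `<=` sharp_set tau B Pinf T.
Proof.
move=> T _ b [Bb [Q CQ]]; split=> //.
exists (distribution Q (first_periods (leqnSn T))).
exact: latent_laws_first_periods.
Qed.
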